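(* Let $\mathcal H$ and $\mathcal K$ be finite dimensional Hilbert spaces. Let $E\subseteq\mathcal M^d$ be a compact set in the free topology, and assume $E$ is polynomially convex. Let $U$ be a free domain containing $E$ and let $\phi$ be a free holomorphic $\mathcal L(\mathcal H,\mathcal K)$-valued function defined on $U$. Then $\phi$ can be uniformly approximated on $E$ by $\mathcal L(\mathcal H,\mathcal K)$-valued free polynomials: for every $\epsilon>0$ there is an $\mathcal L(\mathcal H,\mathcal K)$-valued free polynomial $p$ with $\sup_{x\in E}\|\phi(x)-p(x)\|<\epsilon$.
   Context: $\mathcal M_n$ denotes the $n\times n$ complex matrices and $\mathcal M^d=\bigcup_{n}\mathcal M_n^d$. For a matrix $\delta$ of free polynomials (finite linear combinations of words in noncommuting variables $x^1,\dots,x^d$), $G_\delta=\{M\in\mathcal M^d:\|\delta(M)\|<1\}$ and $K_\delta=\{M\in\mathcal M^d:\|\delta(M)\|\le1\}$. The free topology on $\mathcal M^d$ has the sets $G_\delta$ as a basis; a free domain is a set open in it. The polynomial hull of $E\subseteq\mathcal M^d$ is $\hat E=\bigcap\{K_\delta: E\subseteq K_\delta\}$ (and $\hat E=\mathcal M^d$ if $E$ lies in no $K_\delta$); a compact set is polynomially convex if $E=\hat E$. For Hilbert spaces $\mathcal H,\mathcal K$, an $\mathcal L(\mathcal H,\mathcal K)$-valued graded function assigns to $x\in\mathcal M_n^d$ an operator in $\mathcal L(\mathbb C^n\otimes\mathcal H,\mathbb C^n\otimes\mathcal K)$; it is an nc-function on an nc-domain $D$ (a set closed under direct sums and unitary conjugation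 with each $D\cap\mathcal M_n^d$ open) if $f(x\oplus y)=f(x)\oplus f(y)$ and $f(s^{-1}xs)=(s^{-1}\otimes I_{\mathcal K})f(x)(s\otimes I_{\mathcal H})$ whenever $s$ is invertible and $x,s^{-1}xs\in D$. A free holomorphic $\mathcal L(\mathcal H,\mathcal K)$-valued function on a free domain $U$ is a graded such function such that every $M\in U$ has a basic free open neighbourhood $G_\delta\subseteq U$ on which it is bounded and nc. An $\mathcal L(\mathcal H,\mathcal K)$-valued free polynomial is a finite sum $p(x)=\sum_w w(x)\otimes a_w$ over words $w$, with $a_w\in\mathcal L(\mathcal H,\mathcal K)$. *)

(* Defs.v *)
From HB Require Import structures.
From mathcomp Require Import all_boot all_order all_algebra.
From mathcomp Require Import complex mxtens.
From Stdlib Require List.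
From mathcomp Require Import classical_sets reals.

Set Implicit Arguments.
Unset Strict Implicit.
Unset Printing Implicit Defensive.

Import Order.TTheory GRing.Theory Num.Theory.
Local Open Scope ring_scope.
Local Open Scope classical_set_scope.

Section FreeDefs.
Variable R : realType.
Local Notation C := R[i].
Variable d : nat.

(* A point of M^d = \bigcup_{n>=1} M_n^d : a dimension n.+1 together with a
   d-tuple of (n.+1)x(n.+1) complex matrices. *)
Definition pt := {n : nat & 'I_d -> 'M[C]_n.+1}.
Definition mkpt n (x : 'I_d -> 'M[C]_n.+1) : pt := existT _ n x.

Definition vnorm2 n (v : 'cV[C]_n) : R :=
  \sum_(i < n) ((complex.Re (v i ord0)) ^+ 2 + (complex.Im (v i ord0)) ^+ 2).

Definition opnorm m n (A : 'M[C]_(m, n)) : R :=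
  sup [set Num.sqrt (vnorm2 (A *m v)) | v in [set v : 'cV[C]_n | vnorm2 v <= 1]].

Definition word := seq 'I_d.
Definition word_ev n (w : word) (x : 'I_d -> 'M[C]_n) : 'M[C]_n :=
  foldr (fun i acc => x i *m acc) 1%:M w.

(* L(C^s, C^r)-valued free polynomial: finite sum  sum_w w(x) (x) a_w.
   (An r x s matrix of scalar free polynomials is the same thing.) *)
Definition fpoly (r s : nat) := seq (word * 'M[C]_(r, s)).

(* evaluation; C^n (x) C^r is identified with C^(n*r) via tensmx *)
Definition fpeval r s (p : fpoly r s) n (x : 'I_d -> 'M[C]_n) : 'M[C]_(n * r, n * s) :=
  \sum_(wa <- p) tensmx (word_ev wa.1 x) wa.2.

Definition Gset r s (delta : fpoly r s) : set pt :=
  [set p | opnorm (fpeval delta (projT2 p)) < 1].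
Definition Kset r s (delta : fpoly r s) : set pt :=
  [set p | opnorm (fpeval delta (projT2 p)) <= 1].

(* the free topology: the sets G_delta form a basis *)
Definition free_open (U : set pt) : Prop :=
  forall p, U p -> exists r s (delta : fpoly r s), Gset delta p /\ Gset delta `<=` U.

Definition free_compact (E : set pt) : Prop :=
  forall (I : Type) (V : I -> set pt), (forall i, free_open (V i)) ->
    E `<=` \bigcup_i V i ->
    exists s : seq I, E `<=` \bigcup_(i in [set i | List.In i s]) V i.

(* polynomial hull (equals M^d if E lies in no K_delta) *)
Definition poly_hull (E : set pt) : set pt :=
  [set p | forall r s (delta : fpoly r s), E `<=` Kset delta -> Kset delta p].

Definition poly_convex (E : set pt) : Prop :=
  free_compact E /\ poly_hull E = E.

Definition gfun (k h : nat) :=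
  forall n, ('I_d -> 'M[C]_n.+1) -> 'M[C]_(n.+1 * k, n.+1 * h).

Definition dsum n m (x : 'I_d -> 'M[C]_n.+1) (y : 'I_d -> 'M[C]_m.+1)
  : 'I_d -> 'M[C]_((n + m.+1).+1) :=
  fun i => block_mx (x i) 0 0 (y i).

Definition simil n (s : 'M[C]_n.+1) (x : 'I_d -> 'M[C]_n.+1) : 'I_d -> 'M[C]_n.+1 :=
  fun i => invmx s *m x i *m s.

Definition bounded_on k h (D : set pt) (f : gfun k h) : Prop :=
  exists B : R, forall p, D p -> opnorm (f (projT1 p) (projT2 p)) <= B.

Definition nc_on k h (D : set pt) (f : gfun k h) : Prop :=
  (forall n m (x : 'I_d -> 'M[C]_n.+1) (y : 'I_d -> 'M[C]_m.+1),
     D (mkpt x) -> D (mkpt y) ->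
     f _ (dsum x y) =
     castmx (esym (mulnDl n.+1 m.+1 k), esym (mulnDl n.+1 m.+1 h))
            (block_mx (f n x) 0 0 (f m y)))
  /\
  (forall n (x : 'I_d -> 'M[C]_n.+1) (s : 'M[C]_n.+1),
     s \in unitmx -> D (mkpt x) -> D (mkpt (simil s x)) ->
     f n (simil s x) =
     tensmx (invmx s) (1%:M : 'M[C]_k) *m f n x *m tensmx s (1%:M : 'M[C]_h)).

Definition free_holomorphic k h (U : set pt) (f : gfun k h) : Prop :=
  forall p, U p -> exists r s (delta : fpoly r s),
    [/\ Gset delta p, Gset delta `<=` U, bounded_on (Gset delta) f
      & nc_on (Gset delta) f].

End FreeDefs.

(* Main.v *)
Require Import Defs.
From HB Require Import structures.
From mathcomp Require Import all_boot all_order all_algebra.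
From mathcomp Require Import complex mxtens ring lra.
From mathcomp Require Import boolp classical_sets reals.
Import Order.TTheory GRing.Theory Num.Theory.
Local Open Scope ring_scope.
Local Open Scope classical_set_scope.

(** Compactness in the free topology is so strong that [phi] coincides with a
    polynomial on [E].  Since [E] equals its hull it is closed under direct sums, and
    [G_delta] contains [x (+) y] only if it contains [x] and [y]; hence from any cover
    of [E] by sets [G_delta] a single member already contains [E].  If [q] in [E]
    admits a polynomial [g] vanishing at [q] but not on all of [E], then
    [G_(c g)], for [c] large, is a neighbourhood of [q] not containing [E].  So some [y]
    in [E] is generic: polynomials vanishing at [y] vanish on [E], and moreover
    [E] lies in some [G_delta] on which [phi] is bounded and nc.  At each point of such
    a [G_delta] the value of [phi] is the value of a polynomial.  Interpolating at [y]
    and at [y (+) x] for [x] in [E], genericity forces both polynomials to agree at [x]. *)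

(** * Adjoints, Euclidean norms and operator norms of complex matrices *)

Section OperatorNorm.
Set Implicit Arguments.
Unset Strict Implicit.
Unset Printing Implicit Defensive.
Local Open Scope complex_scope.
Local Open Scope ring_scope.
Variable R : realType.
Local Notation C := R[i].

Definition adjmx m n (A : 'M[C]_(m, n)) : 'M[C]_(n, m) := (map_mx (@conjc R) A)^T.

Lemma adjmxM m n p (A : 'M[C]_(m, n)) (B : 'M[C]_(n, p)) :
  adjmx (A *m B) = adjmx B *m adjmx A.
Proof. by rewrite /adjmx map_mxM trmx_mul. Qed.

Lemma adjmxD m n (A B : 'M[C]_(m, n)) : adjmx (A + B) = adjmx A + adjmx B.
Proof. by rewrite /adjmx map_mxD linearD. Qed.

Lemma adjmxN m n (A : 'M[C]_(m, n)) : adjmx (- A) = - adjmx A.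
Proof. by rewrite /adjmx map_mxN linearN. Qed.

Lemma adjmxZ m n a (A : 'M[C]_(m, n)) : adjmx (a *: A) = a^*%C *: adjmx A.
Proof. by rewrite /adjmx map_mxZ linearZ. Qed.

Lemma adjmxK m n (A : 'M[C]_(m, n)) : adjmx (adjmx A) = A.
Proof. by apply/matrixP => i j; rewrite !mxE conjcK. Qed.

Lemma adjmx1 n : adjmx (1%:M : 'M[C]_n) = 1%:M.
Proof. by rewrite /adjmx map_mx1 trmx1. Qed.

Lemma adjmx_tens m n p q (A : 'M[C]_(m, n)) (B : 'M[C]_(p, q)) :
  adjmx (tensmx A B) = tensmx (adjmx A) (adjmx B).
Proof. by rewrite /adjmx map_mxT trmx_tens. Qed.

Lemma mulmx_ext m n (A B : 'M[C]_(m, n)) :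
  (forall v : 'cV[C]_n, A *m v = B *m v) -> A = B.
Proof.
move=> AB; apply/matrixP => i j.
by move: (AB (delta_mx j 0)); rewrite -!colE => /matrixP/(_ i 0); rewrite !mxE.
Qed.

(** Turns norm identities into matrix algebra: isometries and the Pythagorean theorem below are read
    off the single entry of this 1 by 1 matrix. *)
Lemma vnorm2E n (v : 'cV[C]_n) : adjmx v *m v = ((vnorm2 v)%:C)%:M.
Proof.
apply/matrixP => i j; rewrite !ord1 !mxE eqxx mulr1n /vnorm2 rmorph_sum /=.
apply: eq_bigr => l _; rewrite !mxE.
by rewrite -[RHS]/(real_complex R _) add_Re2_Im2 sqr_normc mulrC.
Qed.

Lemma vnorm2_ge0 n (v : 'cV[C]_n) : 0 <= vnorm2 v.
Proof. by apply: sumr_ge0 => i _; rewrite addr_ge0 ?sqr_ge0. Qed.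

Lemma vnorm2_eq0 n (v : 'cV[C]_n) : vnorm2 v = 0 -> v = 0.
Proof.
move=> v0; apply/matrixP => i j; rewrite ord1 mxE.
have h l : true -> 0 <= (complex.Re (v l 0)) ^+ 2 + (complex.Im (v l 0)) ^+ 2.
  by rewrite addr_ge0 ?sqr_ge0.
have := psumr_eq0P h v0 (erefl : xpredT i).
move/eqP; rewrite paddr_eq0 ?sqr_ge0 // !sqrf_eq0 => /andP[/eqP re0 /eqP im0].
by rewrite [v i 0]complexE re0 im0 mulr0 addr0.
Qed.

Lemma vnorm20 n : vnorm2 (0 : 'cV[C]_n) = 0.
Proof. by apply: big1 => i _; rewrite mxE /= expr0n /= addr0. Qed.

Lemma vnorm2Z n (a : C) (v : 'cV[C]_n) :
  vnorm2 (a *: v) = (complex.Re a ^+ 2 + complex.Im a ^+ 2) * vnorm2 v.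
Proof.
rewrite /vnorm2 mulr_sumr; apply: eq_bigr => i _; rewrite mxE.
by case: a => a b; case: (v i 0) => c e /=; ring.
Qed.

Lemma vnorm2ZR n (a : R) (v : 'cV[C]_n) : vnorm2 (a%:C *: v) = a ^+ 2 * vnorm2 v.
Proof. by rewrite vnorm2Z /= expr0n addr0. Qed.

(** The two sides differ by [a (1 - a) |u - v|^2], coordinate by coordinate. *)
Lemma vnorm2_convex n (a : R) (u v : 'cV[C]_n) : 0 <= a <= 1 ->
  vnorm2 (a%:C *: u + (1 - a)%:C *: v) <= a * vnorm2 u + (1 - a) * vnorm2 v.
Proof.
move=> /andP[a0 a1]; rewrite /vnorm2 !mulr_sumr -big_split /=.
apply: ler_sum => i _; rewrite !mxE.
case: (u i 0) => x y; case: (v i 0) => z w /=; rewrite !mul0r !subr0 !addr0 -subr_ge0.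
set e := (X in 0 <= X).
have -> : e = a * (1 - a) * ((x - z) ^+ 2 + (y - w) ^+ 2) by rewrite /e; ring.
by rewrite !mulr_ge0 ?subr_ge0 // addr_ge0 ?sqr_ge0.
Qed.

Lemma vnorm2D n (u v : 'cV[C]_n) : vnorm2 (u + v) <= 2 * vnorm2 u + 2 * vnorm2 v.
Proof.
rewrite /vnorm2 !mulr_sumr -big_split /=; apply: ler_sum => i _; rewrite !mxE.
case: (u i 0) => x y; case: (v i 0) => z w /=; rewrite -subr_ge0.
set e := (X in 0 <= X).
have -> : e = (x - z) ^+ 2 + (y - w) ^+ 2 by rewrite /e; ring.
by rewrite addr_ge0 ?sqr_ge0.
Qed.

Lemma vnorm2_isometry m n (J : 'M[C]_(m, n)) (v : 'cV[C]_n) :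
  adjmx J *m J = 1%:M -> vnorm2 (J *m v) = vnorm2 v.
Proof.
move=> JJ; have := vnorm2E (J *m v).
rewrite adjmxM mulmxA -(mulmxA _ _ J) JJ mulmx1 vnorm2E => /matrixP/(_ 0 0).
by rewrite !mxE eqxx !mulr1n => -[].
Qed.

Lemma vnorm2_col_mx m n (u : 'cV[C]_m) (v : 'cV[C]_n) :
  vnorm2 (col_mx u v) = vnorm2 u + vnorm2 v.
Proof.
rewrite /vnorm2 big_split_ord /=; congr (_ + _); apply: eq_bigr => i _.
  by rewrite col_mxEu.
by rewrite col_mxEd.
Qed.

(** Ensures that the supremum in [opnorm] is taken over a bounded set. Matrices with such a bound
    include 0 and are closed under sums, so it suffices to treat a multiple of one matrix unit. *)
Lemma vnorm2_mul_bound m n (A : 'M[C]_(m, n)) :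
  exists2 M : R, 0 <= M & forall v, vnorm2 (A *m v) <= M * vnorm2 v.
Proof.
pose bdd (B : 'M[C]_(m, n)) :=
  exists2 M : R, 0 <= M & forall v : 'cV[C]_n, vnorm2 (B *m v) <= M * vnorm2 v.
have bdd0 : bdd (0 : 'M[C]_(m, n)).
  by exists 0 => // v; rewrite mul0mx vnorm20 mul0r.
have bddD (B1 B2 : 'M[C]_(m, n)) : bdd B1 -> bdd B2 -> bdd (B1 + B2).
  move=> [M1 M10 h1] [M2 M20 h2]; exists (2 * M1 + 2 * M2) => [|v].
    by rewrite addr_ge0 ?mulr_ge0.
  rewrite mulmxDl (le_trans (vnorm2D _ _))// [leRHS]mulrDl -!mulrA.
  by rewrite lerD // ler_wpM2l.
rewrite (matrix_sum_delta A) -/(bdd _).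
apply: (big_ind bdd) => // i _; apply: (big_ind bdd) => //.
move=> j _; exists (complex.Re (A i j) ^+ 2 + complex.Im (A i j) ^+ 2) => [|v].
  by rewrite addr_ge0 ?sqr_ge0.
rewrite -scalemxAl vnorm2Z ler_wpM2l ?addr_ge0 ?sqr_ge0 //.
rewrite /vnorm2 (bigD1 i) //= [X in _ + X]big1 => [|l li]; last first.
  rewrite mxE big1 /= ?expr0n /= ?addr0 // => t _.
  by rewrite mxE (negPf li) mul0r.
rewrite addr0 mxE (bigD1 j) //= big1 => [|t tj]; last first.
  by rewrite mxE (negPf tj) andbF mul0r.
rewrite mxE !eqxx mul1r addr0 (bigD1 j) //= lerDl.
by apply: sumr_ge0 => t _; rewrite addr_ge0 ?sqr_ge0.
Qed.

Lemma opnorm_set_ubound m n (A : 'M[C]_(m, n)) :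
  has_ubound [set Num.sqrt (vnorm2 (A *m v)) | v in [set v : 'cV[C]_n | vnorm2 v <= 1]].
Proof.
have [M M0 hM] := vnorm2_mul_bound A.
exists (Num.sqrt M) => _ [v /= v1 <-]; rewrite ler_wsqrtr //.
by rewrite (le_trans (hM v)) // ler_piMr.
Qed.

Lemma opnorm_ge0 m n (A : 'M[C]_(m, n)) : 0 <= opnorm A.
Proof.
apply: (ub_le_sup (opnorm_set_ubound A)).
by exists 0 => /=; rewrite ?mulmx0 vnorm20 ?sqrtr0.
Qed.

Lemma opnorm_le m n (A : 'M[C]_(m, n)) (c : R) : 0 <= c ->
  (forall v, vnorm2 (A *m v) <= c ^+ 2 * vnorm2 v) -> opnorm A <= c.
Proof.
move=> c0 hA; apply: ge_sup.
  by exists (Num.sqrt (vnorm2 (A *m 0))), 0; rewrite /= ?vnorm20.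
move=> _ [v /= v1 <-]; rewrite -(ger0_norm c0) -sqrtr_sqr ler_wsqrtr //.
by rewrite (le_trans (hA v)) // ler_piMr ?sqr_ge0.
Qed.

Lemma vnorm2_mul_le m n (A : 'M[C]_(m, n)) v :
  vnorm2 (A *m v) <= opnorm A ^+ 2 * vnorm2 v.
Proof.
have [->|v0] := eqVneq v 0; first by rewrite mulmx0 !vnorm20 mulr0.
have vp : 0 < vnorm2 v.
  rewrite lt_neqAle vnorm2_ge0 andbT eq_sym.
  by apply: contra_neq v0 => /vnorm2_eq0.
have rp : 0 < Num.sqrt (vnorm2 v) by rewrite sqrtr_gt0.
set r := Num.sqrt (vnorm2 v) in rp.
have rE : r ^+ 2 = vnorm2 v by rewrite sqr_sqrtr // ltW.
have : Num.sqrt (vnorm2 (A *m (r^-1%:C *: v))) <= opnorm A.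
  apply: (ub_le_sup (opnorm_set_ubound A)); exists (r^-1%:C *: v) => //=.
  by rewrite vnorm2ZR -rE -exprMn mulVf ?gt_eqF // expr1n.
rewrite -(@ler_pXn2r _ 2) ?nnegrE ?sqrtr_ge0 ?opnorm_ge0 //.
rewrite sqr_sqrtr ?vnorm2_ge0 // -scalemxAr vnorm2ZR -rE => le.
by rewrite -ler_pdivrMr ?exprn_gt0 // mulrC -exprVn.
Qed.

Lemma opnorm0 m n : opnorm (0 : 'M[C]_(m, n)) = 0.
Proof.
apply/eqP; rewrite eq_le opnorm_ge0 andbT; apply: opnorm_le => // v.
by rewrite mul0mx vnorm20 expr0n mul0r.
Qed.

(** If [A v] is nonzero, the factor [c = |v| / |A v|] gives [c A v] the length of [v]. This is what
    later pushes a point out of a set [G_(c g)]. *)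
Lemma opnorm_scale_ge1 m n (A : 'M[C]_(m, n)) : A <> 0 ->
  exists c : C, 1 <= opnorm (c *: A).
Proof.
move=> A0.
have [v Av] : exists v : 'cV[C]_n, A *m v <> 0.
  by apply/existsNP => h; apply: A0; apply: mulmx_ext => v; rewrite h mul0mx.
have np n' (w : 'cV[C]_n') : w <> 0 -> 0 < vnorm2 w.
  by move=> w0; rewrite lt_neqAle vnorm2_ge0 andbT eq_sym; apply/eqP => /vnorm2_eq0.
have vp : 0 < vnorm2 v by apply: np => v0; rewrite v0 mulmx0 in Av.
have Avp := np _ _ Av.
exists (Num.sqrt (vnorm2 v / vnorm2 (A *m v)))%:C.
set c := Num.sqrt _.
have cE : c ^+ 2 * vnorm2 (A *m v) = vnorm2 v.
  by rewrite sqr_sqrtr ?divr_ge0 ?vnorm2_ge0 // divfK // gt_eqF.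
have := vnorm2_mul_le (c%:C *: A) v.
rewrite -scalemxAl vnorm2ZR cE -ler_pdivrMr // divff ?gt_eqF //.
by rewrite -[X in X <= _](expr1n _ 2) ler_pXn2r ?nnegrE ?opnorm_ge0.
Qed.

Lemma opnorm_castmx m m' n n' (em : m = m') (en : n = n') (A : 'M[C]_(m, n)) :
  opnorm (castmx (em, en) A) = opnorm A.
Proof. by case: m' / em; case: n' / en; rewrite castmx_id. Qed.

Lemma mul_block_diag_col m1 m2 n1 n2 (A : 'M[C]_(m1, n1)) (B : 'M[C]_(m2, n2)) p
    (u : 'M[C]_(n1, p)) (v : 'M[C]_(n2, p)) :
  block_mx A 0 0 B *m col_mx u v = col_mx (A *m u) (B *m v).
Proof. by rewrite mul_block_col !mul0mx addr0 add0r. Qed.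

Lemma opnorm_block_le m1 m2 n1 n2 (A : 'M[C]_(m1, n1)) (B : 'M[C]_(m2, n2)) (c : R) :
  opnorm A <= c -> opnorm B <= c -> opnorm (block_mx A 0 0 B) <= c.
Proof.
move=> Ac Bc; apply: opnorm_le => [|v]; first exact: le_trans (opnorm_ge0 A) Ac.
rewrite -[v]vsubmxK mul_block_diag_col !vnorm2_col_mx mulrDr.
have sq x : 0 <= x -> x <= c -> x ^+ 2 <= c ^+ 2.
  by move=> x0 xc; rewrite lerXn2r // nnegrE // (le_trans x0).
by rewrite lerD // (le_trans (vnorm2_mul_le _ _)) // ler_wpM2r ?vnorm2_ge0 //
   sq ?opnorm_ge0.
Qed.

Lemma opnorm_block_gel m1 m2 n1 n2 (A : 'M[C]_(m1, n1)) (B : 'M[C]_(m2, n2)) :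
  opnorm A <= opnorm (block_mx A 0 0 B).
Proof.
apply: opnorm_le => [|v]; first exact: opnorm_ge0.
have := vnorm2_mul_le (block_mx A 0 0 B) (col_mx v 0).
by rewrite mul_block_diag_col !vnorm2_col_mx mulmx0 !vnorm20 !addr0.
Qed.

Lemma opnorm_block_ger m1 m2 n1 n2 (A : 'M[C]_(m1, n1)) (B : 'M[C]_(m2, n2)) :
  opnorm B <= opnorm (block_mx A 0 0 B).
Proof.
apply: opnorm_le => [|v]; first exact: opnorm_ge0.
have := vnorm2_mul_le (block_mx A 0 0 B) (col_mx 0 v).
by rewrite mul_block_diag_col !vnorm2_col_mx mulmx0 !vnorm20 !add0r.
Qed.

(** * Orthogonal projections and dilations along them *)

Definition orthoproj n (P : 'M[C]_n) := P *m P = P /\ adjmx P = P.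

Lemma orthoproj_tens1 n k (P : 'M[C]_n) :
  orthoproj P -> orthoproj (tensmx P (1%:M : 'M[C]_k)).
Proof.
by move=> [PP aP]; split; rewrite ?tensmx_mul ?adjmx_tens ?PP ?aP ?mulmx1 ?adjmx1.
Qed.

Lemma orthoproj_reflection n (P : 'M[C]_n) : orthoproj P ->
  adjmx (P + P - 1%:M) *m (P + P - 1%:M) = 1%:M.
Proof.
move=> [PP aP]; rewrite !adjmxD adjmxN adjmx1 aP.
rewrite !(mulmxDl, mulmxDr, mulNmx, mulmxN, mul1mx, mulmx1) PP opprK.
apply/matrixP => i j; rewrite !mxE; ring.
Qed.

Lemma orthoproj_pythagoras n (P : 'M[C]_n) (v : 'cV[C]_n) : orthoproj P ->
  vnorm2 v = vnorm2 (P *m v) + vnorm2 ((1%:M - P) *m v).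
Proof.
move=> [PP aP].
have e : adjmx v *m v = adjmx (P *m v) *m (P *m v)
   + adjmx ((1%:M - P) *m v) *m ((1%:M - P) *m v).
  have QQ : (1%:M - P) *m (1%:M - P) = 1%:M - P.
    by rewrite mulmxBr mulmx1 mulmxBl mul1mx PP subrr subr0.
  rewrite !adjmxM adjmxD adjmxN adjmx1 aP !mulmxA -(mulmxA _ P P) PP.
  by rewrite -(mulmxA _ (1%:M - P) (1%:M - P)) QQ -mulmxDl -mulmxDr addrC subrK mulmx1.
move: e; rewrite !vnorm2E => /matrixP/(_ 0 0); rewrite !mxE eqxx !mulr1n.
by rewrite -rmorphD => -[].
Qed.

Lemma orthoproj_contract n (P : 'M[C]_n) (v : 'cV[C]_n) : orthoproj P ->
  vnorm2 (P *m v) <= vnorm2 v.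
Proof. by move=> hP; rewrite (orthoproj_pythagoras v hP) lerDl vnorm2_ge0. Qed.

Lemma orthoproj_contractC n (P : 'M[C]_n) (v : 'cV[C]_n) : orthoproj P ->
  vnorm2 ((1%:M - P) *m v) <= vnorm2 v.
Proof. by move=> hP; rewrite (orthoproj_pythagoras v hP) lerDr vnorm2_ge0. Qed.

(* The matrix on the left is a convex combination of [D] and of its conjugate by
   the reflections [2P - 1], which are unitary. *)
Lemma opnorm_dilation m n (P1 : 'M[C]_m) (P2 : 'M[C]_n) (D : 'M[C]_(m, n)) (t : R) :
  orthoproj P1 -> orthoproj P2 -> P1 *m D *m P2 = D *m P2 -> 1 <= t ->
  opnorm ((1%:M + (t^-1 - 1)%:C *: P1) *m D *m (1%:M + (t - 1)%:C *: P2))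
    <= opnorm D.
Proof.
move=> h1 h2 inv t1.
have t0 : t != 0 by rewrite gt_eqF // (lt_le_trans ltr01).
pose J1 := P1 + P1 - 1%:M; pose J2 := P2 + P2 - 1%:M.
pose a := (1 + t^-1) / 2.
have -> : (1%:M + (t^-1 - 1)%:C *: P1) *m D *m (1%:M + (t - 1)%:C *: P2) =
   a%:C *: D + (1 - a)%:C *: (J1 *m D *m J2).
  rewrite /J1 /J2.
  rewrite !(mulmxDl, mulmxDr, mulNmx, mulmxN, mul1mx, mulmx1) -!scalemxAl -!scalemxAr.
  rewrite inv; move: (D *m P2) (P1 *m D) => X Y.
  apply/matrixP => i j; rewrite !mxE.
  case: (X i j) => x1 x2; case: (Y i j) => y1 y2; case: (D i j) => d1 d2.
  by apply/eqP; rewrite eq_complex /=; apply/andP; split; apply/eqP; rewrite /a; field.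
have ab : 0 <= a <= 1.
  have ti : 0 <= t^-1 <= 1 by rewrite invr_ge0 (le_trans ler01) //= invf_le1 // (lt_le_trans ltr01).
  by rewrite /a; lra.
apply: opnorm_le => [|v]; first exact: opnorm_ge0.
rewrite mulmxDl -!scalemxAl (le_trans (vnorm2_convex _ _ ab)) //.
have DJ : vnorm2 (J1 *m D *m J2 *m v) <= opnorm D ^+ 2 * vnorm2 v.
  rewrite -!mulmxA (@vnorm2_isometry _ _ J1) ?orthoproj_reflection //.
  rewrite (le_trans (vnorm2_mul_le _ _)) // (@vnorm2_isometry _ _ J2) //.
  exact: orthoproj_reflection.
have {ab} [a0 a1] : 0 <= a /\ 0 <= 1 - a by split; lra.
rewrite (le_trans (lerD (ler_wpM2l a0 (vnorm2_mul_le D v)) (ler_wpM2l a1 DJ))) //.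
by rewrite -mulrDl addrC subrK mul1r.
Qed.

(** The dilation multiplies the corner [(1 - P1) F P2] by [t]. A bound uniform in [t] therefore
    forces this corner to vanish. *)
Lemma orthoproj_dilation_bounded m n (P1 : 'M[C]_m) (P2 : 'M[C]_n) (F : 'M[C]_(m, n))
    (B : R) : orthoproj P1 -> orthoproj P2 ->
  (forall t : R, 1 <= t ->
    opnorm ((1%:M + (t^-1 - 1)%:C *: P1) *m F *m (1%:M + (t - 1)%:C *: P2)) <= B) ->
  P1 *m F *m P2 = F *m P2.
Proof.
move=> h1 h2 bnd; apply/eqP; rewrite eq_sym -subr_eq0; apply/eqP.
apply: mulmx_ext => v; rewrite mul0mx; apply: vnorm2_eq0; apply/eqP.
rewrite eq_le vnorm2_ge0 andbT leNgt; apply/negP.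
set w := vnorm2 _ => w0.
(* Chosen so that [t w = w + B^2 |v|^2], whereas the bound on [G] gives
   [t w <= t^2 w <= B^2 |v|^2]. *)
pose t := 1 + B ^+ 2 * vnorm2 v / w.
have Bv0 : 0 <= B ^+ 2 * vnorm2 v by rewrite mulr_ge0 ?sqr_ge0 ?vnorm2_ge0.
have t1 : 1 <= t by rewrite lerDl divr_ge0 // ltW.
have := bnd t t1; set G := (X in opnorm X) => GB.
have QG : (1%:M - P1) *m G = (1%:M - P1) *m F *m (1%:M + (t - 1)%:C *: P2).
  rewrite /G !mulmxA; congr (_ *m _ *m _).
  by rewrite mulmxDr mulmx1 -scalemxAr mulmxBl mul1mx (proj1 h1) subrr scaler0 addr0.
have tP2 : (1%:M + (t - 1)%:C *: P2) *m P2 = t%:C *: P2.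
  by rewrite mulmxDl mul1mx -scalemxAl (proj1 h2) rmorphB scalerBl scale1r addrC subrK.
have tG : t%:C *: ((F *m P2 - P1 *m F *m P2) *m v) = (1%:M - P1) *m (G *m (P2 *m v)).
  rewrite (mulmxA _ G) QG (mulmxA _ P2) -(mulmxA _ (1%:M + _) P2) tP2 -scalemxAr -scalemxAl.
  by rewrite (mulmxBl _ _ F) mul1mx -(mulmxBl _ _ P2).
have le1 : t ^+ 2 * w <= B ^+ 2 * vnorm2 v.
  rewrite /w -vnorm2ZR tG (le_trans (orthoproj_contractC _ h1)) //.
  rewrite (le_trans (vnorm2_mul_le _ _)) // ler_pM ?sqr_ge0 ?vnorm2_ge0 //.
    by rewrite lerXn2r // nnegrE ?opnorm_ge0 // (le_trans (opnorm_ge0 _) GB).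
  exact: orthoproj_contract.
have : t * w <= t ^+ 2 * w.
  by rewrite (ler_wpM2r (ltW w0)) // expr2 ler_peMl // (le_trans ler01).
rewrite {1}/t mulrDl mul1r divfK ?gt_eqF // => le2.
by have := le_trans le2 le1; rewrite gerDr leNgt w0.
Qed.

(** Gram-Schmidt for a subspace given only as a predicate: as long as [P] does not fix all of [V],
    the rank-one projection onto a residual [u - P u] is added to it. *)
Lemma orthoproj_exists n (V : 'cV[C]_n -> Prop) :
  V 0 -> (forall u v, V u -> V v -> V (u + v)) -> (forall a u, V u -> V (a *: u)) ->
  exists P : 'M[C]_n,
    [/\ orthoproj P, forall u, V (P *m u) & forall u, V u -> P *m u = u].
Proof.
move=> V0 VD VZ.
(* Either the process has stopped or the rank has reached [l]; the second case is impossible for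
   [l = n + 1]. *)
have main l : (exists P : 'M[C]_n,
    [/\ orthoproj P, forall u, V (P *m u) & forall u, V u -> P *m u = u]) \/
  (exists P : 'M[C]_n,
    [/\ orthoproj P, forall u, V (P *m u) & (l <= \rank P)%N]).
  elim: l => [|l [|[P [hP VP rP]]]]; [right|by left|].
    exists 0; split=> // [|u]; last by rewrite mul0mx.
    split; first by rewrite mul0mx.
    by apply/matrixP => i j; rewrite !mxE; exact: conjc0.
  have [fixV|/existsNP[u /not_implyP[Vu Pu]]] :=
    pselect (forall u, V u -> P *m u = u); first by left; exists P.
  right; case: hP => PP aP; pose w := u - P *m u.
  have w0 : w != 0 by rewrite subr_eq0 eq_sym; apply/eqP.
  have Vw : V w by apply: VD => //; rewrite -scaleN1r; apply: VZ.
  have Pw : P *m w = 0 by rewrite /w mulmxBr mulmxA PP subrr.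
  have wP : adjmx w *m P = 0.
    by rewrite -aP -adjmxM Pw; apply/matrixP => i j; rewrite !mxE; exact: conjc0.
  set c : C := (vnorm2 w)%:C.
  have c0 : c != 0.
    apply: contra_neq w0 => -[] /vnorm2_eq0 ->//.
  pose Q := c^-1 *: (w *m adjmx w).
  have PQ : P *m Q = 0 by rewrite /Q -scalemxAr mulmxA Pw mul0mx scaler0.
  have QP : Q *m P = 0 by rewrite /Q -scalemxAl -mulmxA wP mulmx0 scaler0.
  have Qw : Q *m w = w.
    by rewrite /Q -scalemxAl -mulmxA vnorm2E mul_mx_scalar scalerA mulVf // scale1r.
  have QQ : Q *m Q = Q by rewrite {2}/Q -scalemxAr mulmxA Qw.
  have aQ : adjmx Q = Q.
    rewrite /Q adjmxZ adjmxM adjmxK conjc_inv; congr (_^-1 *: _).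
    exact: conjc_real.
  exists (P + Q); split.
  - by split; rewrite ?adjmxD ?aP ?aQ // mulmxDl !mulmxDr PP PQ QP QQ addr0 add0r.
  - move=> x; rewrite mulmxDl; apply: VD; first exact: VP.
    rewrite /Q -scalemxAl -mulmxA [adjmx w *m x]mx11_scalar mul_mx_scalar.
    exact: (VZ _ _ (VZ _ _ Vw)).
  (* The row space grows strictly: [P = P (P + Q)], while [P] kills [w] and [P + Q] does not. *)
  apply: leq_ltn_trans rP _; apply: rank_ltmx; rewrite /ltmx; apply/andP; split.
    by apply/submxP; exists P; rewrite mulmxDr PP PQ addr0.
  apply/negP => /submxP[X PQX].
  have : (P + Q) *m w = 0 by rewrite PQX -mulmxA Pw mulmx0.
  by rewrite mulmxDl Pw Qw add0r; move/eqP; rewrite (negPf w0).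
have [//|[P [_ _ rP]]] := main n.+1.
by have := leq_trans rP (rank_leq_row P); rewrite ltnn.
Qed.

End OperatorNorm.

(** * Tensor products of matrices and block-diagonal sums *)

Section FreePolynomials.
Set Implicit Arguments.
Unset Strict Implicit.
Unset Printing Implicit Defensive.
Local Open Scope complex_scope.
Local Open Scope ring_scope.
Variables (R : realType) (d : nat).
Local Notation C := R[i].

Lemma castmxD m m' n n' (em : m = m') (en : n = n') (A B : 'M[C]_(m, n)) :
  castmx (em, en) (A + B) = castmx (em, en) A + castmx (em, en) B.
Proof. by case: m' / em; case: n' / en; rewrite !castmx_id. Qed.

Lemma castmx0 m m' n n' (em : m = m') (en : n = n') :
  castmx (em, en) (0 : 'M[C]_(m, n)) = 0.
Proof. by case: m' / em; case: n' / en; rewrite !castmx_id. Qed.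

Lemma castmx_injective m m' n n' (em : m = m') (en : n = n') :
  injective (castmx (em, en) : 'M[C]_(m, n) -> _).
Proof. by case: m' / em; case: n' / en => A B; rewrite !castmx_id. Qed.

(** The first tensor factor is the slow index, so cutting it into two blocks cuts the product range
    into two consecutive intervals. *)
Lemma cast_mxtens_lshift n m k (i : 'I_n) (a : 'I_k) :
  cast_ord (mulnDl n m k) (mxtens_index (lshift m i, a)) =
  lshift (m * k)%N (mxtens_index (i, a)).
Proof. exact: val_inj. Qed.

Lemma cast_mxtens_rshift n m k (i : 'I_m) (a : 'I_k) :
  cast_ord (mulnDl n m k) (mxtens_index (rshift n i, a)) =
  rshift (n * k)%N (mxtens_index (i, a)).
Proof. by apply: val_inj; rewrite /= mulnDl addnA. Qed.

Definition cast_mxtens := (cast_mxtens_lshift, cast_mxtens_rshift).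

Lemma tensmx_block_diag m1 m2 n1 n2 p q (A : 'M[C]_(m1, n1)) (B : 'M[C]_(m2, n2))
    (M : 'M[C]_(p, q)) :
  tensmx (block_mx A 0 0 B) M =
  castmx (esym (mulnDl m1 m2 p), esym (mulnDl n1 n2 q))
    (block_mx (tensmx A M) 0 0 (tensmx B M)).
Proof.
apply/matrixP => i j; rewrite castmxE !esymK.
case: (mxtens_indexP i) => i0 i1; case: (mxtens_indexP j) => j0 j1.
rewrite tensmxE -[i0]splitK -[j0]splitK.
case: (split i0) => i0'; case: (split j0) => j0' /=; rewrite !cast_mxtens.
- by rewrite !block_mxEul tensmxE.
- by rewrite !block_mxEur !mxE mul0r.
- by rewrite !block_mxEdl !mxE mul0r.
- by rewrite !block_mxEdr tensmxE.
Qed.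

Lemma tensmxDl m n p q (A B : 'M[C]_(m, n)) (M : 'M[C]_(p, q)) :
  tensmx (A + B) M = tensmx A M + tensmx B M.
Proof. by apply/matrixP => i j; rewrite !mxE mulrDl. Qed.

Lemma tensmxZl m n p q c (A : 'M[C]_(m, n)) (M : 'M[C]_(p, q)) :
  tensmx (c *: A) M = tensmx A (c *: M).
Proof. by apply/matrixP => i j; rewrite !mxE mulrCA mulrA. Qed.

Lemma tensmxZr m n p q c (A : 'M[C]_(m, n)) (M : 'M[C]_(p, q)) :
  tensmx A (c *: M) = c *: tensmx A M.
Proof. by apply/matrixP => i j; rewrite !mxE mulrCA. Qed.

Lemma tensmx11 n k : tensmx 1%:M 1%:M = 1%:M :> 'M[C]_(n * k).
Proof.
apply/matrixP => i j.
case: (mxtens_indexP i) => i0 i1; case: (mxtens_indexP j) => j0 j1.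
by rewrite tensmxE !mxE (can_eq (@mxtens_indexK _ _)) xpair_eqE -natrM mulnb.
Qed.

Lemma tensmx1DZ n k (c : C) (P : 'M[C]_n) :
  tensmx (1%:M + c *: P) (1%:M : 'M[C]_k) = 1%:M + c *: tensmx P 1%:M.
Proof. by rewrite tensmxDl tensmx11 tensmxZl tensmxZr. Qed.

(** * Scalar slices of operator-valued matrices *)

Definition entry k h (a : 'I_k) (b : 'I_h) m n (F : 'M[C]_(m * k, n * h)) : 'M[C]_(m, n) :=
  \matrix_(i, j) F (mxtens_index (i, a)) (mxtens_index (j, b)).

Lemma sum_mxtens n k (G : 'I_(n * k) -> C) :
  \sum_l G l = \sum_i \sum_a G (mxtens_index (i, a)).
Proof.
rewrite pair_bigA /= (reindex (@mxtens_index n k)) /=.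
  by apply: eq_bigr => -[i a] _.
by exists (@mxtens_unindex n k) => x _; rewrite ?mxtens_indexK ?mxtens_unindexK.
Qed.

(** Slices index the second tensor factor, on which the outer matrices act as the identity. Hence
    the slices of an nc-function transform under similarity like scalar nc-functions. *)
Lemma entry_tensmul k h (a : 'I_k) (b : 'I_h) m m' n n' (A : 'M[C]_(m', m))
    (F : 'M[C]_(m * k, n * h)) (B : 'M[C]_(n, n')) :
  entry a b (tensmx A 1%:M *m F *m tensmx B 1%:M) = A *m entry a b F *m B.
Proof.
apply/matrixP => i j; rewrite !mxE sum_mxtens; apply: eq_bigr => l _.
rewrite (bigD1 b) //= big1 ?addr0 => [|b' b'b]; last first.
  by rewrite tensmxE [1%:M _ _]mxE (negPf b'b) mulr0 mulr0.
rewrite tensmxE [1%:M _ _]mxE eqxx mulr1; congr (_ * _).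
rewrite !mxE sum_mxtens; apply: eq_bigr => l' _.
rewrite (bigD1 a) //= big1 ?addr0 => [|a' a'a]; last first.
  by rewrite tensmxE [1%:M _ _]mxE eq_sym (negPf a'a) mulr0 mul0r.
by rewrite tensmxE [1%:M _ _]mxE eqxx mulr1 mxE.
Qed.

Lemma entry_block_diag k h (a : 'I_k) (b : 'I_h) n m
    (F : 'M[C]_(n * k, n * h)) (G : 'M[C]_(m * k, m * h)) :
  entry a b (castmx (esym (mulnDl n m k), esym (mulnDl n m h)) (block_mx F 0 0 G)) =
  block_mx (entry a b F) 0 0 (entry a b G).
Proof.
apply/matrixP => i0 j0; rewrite mxE castmxE !esymK -[i0]splitK -[j0]splitK.
case: (split i0) => i'; case: (split j0) => j' /=; rewrite !cast_mxtens.
- by rewrite !block_mxEul mxE.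
- by rewrite !block_mxEur !mxE.
- by rewrite !block_mxEdl !mxE.
- by rewrite !block_mxEdr mxE.
Qed.

Lemma entry_sum k h m n (F : 'M[C]_(m * k, n * h)) :
  F = \sum_a \sum_b tensmx (entry a b F) (delta_mx a b).
Proof.
apply/matrixP => i j.
case: (mxtens_indexP i) => i0 i1; case: (mxtens_indexP j) => j0 j1.
rewrite summxE (bigD1 i1) //= [X in _ + X]big1 ?addr0 => [|a ai]; last first.
  rewrite summxE big1 // => b _.
  by rewrite tensmxE [delta_mx _ _ _ _]mxE eq_sym (negPf ai) mulr0.
rewrite summxE (bigD1 j1) //= [X in _ + X]big1 ?addr0 => [|b bj]; last first.
  by rewrite tensmxE [delta_mx _ _ _ _]mxE [j1 == b]eq_sym (negPf bj) andbF mulr0.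
by rewrite tensmxE [delta_mx _ _ _ _]mxE !eqxx mulr1 mxE.
Qed.

(** * Free polynomials at direct sums and at similar points *)

Lemma word_ev_dsum n m (x : 'I_d -> 'M[C]_n.+1) (y : 'I_d -> 'M[C]_m.+1) w :
  word_ev w (dsum x y) = block_mx (word_ev w x) 0 0 (word_ev w y)
    :> 'M[C]_(n.+1 + m.+1).
Proof.
elim: w => [|i w IH] /=; first exact: scalar_mx_block.
rewrite IH -[LHS]/(block_mx (x i) 0 0 (y i) *m block_mx (word_ev w x) 0 0 (word_ev w y)).
by rewrite mulmx_block !mulmx0 !mul0mx !addr0 !add0r.
Qed.

Lemma fpeval_dsum r s (p : fpoly R d r s) n m (x : 'I_d -> 'M[C]_n.+1)
    (y : 'I_d -> 'M[C]_m.+1) :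
  fpeval p (dsum x y) =
  castmx (esym (mulnDl n.+1 m.+1 r), esym (mulnDl n.+1 m.+1 s))
    (block_mx (fpeval p x) 0 0 (fpeval p y)).
Proof.
rewrite /fpeval; elim: p => [|[w c] p IH].
  by rewrite !big_nil block_mx0 castmx0.
rewrite !big_cons /= IH word_ev_dsum.
rewrite (tensmx_block_diag (word_ev w x) (word_ev w y)) -castmxD.
by rewrite add_block_mx !addr0.
Qed.

Lemma word_ev_simil n (x : 'I_d -> 'M[C]_n.+1) (s : 'M[C]_n.+1) w :
  s \in unitmx -> word_ev w (simil s x) = invmx s *m word_ev w x *m s.
Proof.
move=> us; elim: w => [|i w IH] /=; first by rewrite mulmx1 mulVmx.
by rewrite IH /simil !mulmxA -(mulmxA _ s (invmx s)) mulmxV // mulmx1.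
Qed.

Lemma fpeval_simil r s (p : fpoly R d r s) n (x : 'I_d -> 'M[C]_n.+1) (g : 'M[C]_n.+1) :
  g \in unitmx ->
  fpeval p (simil g x) = tensmx (invmx g) 1%:M *m fpeval p x *m tensmx g 1%:M.
Proof.
move=> ug; rewrite /fpeval mulmx_sumr mulmx_suml; apply: eq_bigr => wa _.
by rewrite word_ev_simil // !tensmx_mul mul1mx mulmx1.
Qed.

Lemma fpeval_cat r s (p q : fpoly R d r s) n (x : 'I_d -> 'M[C]_n) :
  fpeval (p ++ q) x = fpeval p x + fpeval q x.
Proof. by rewrite /fpeval big_cat. Qed.

Definition fpscale r s (c : C) (p : fpoly R d r s) : fpoly R d r s :=
  [seq (wa.1, c *: wa.2) | wa <- p].

Lemma fpeval_scale r s c (p : fpoly R d r s) n (x : 'I_d -> 'M[C]_n) :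
  fpeval (fpscale c p) x = c *: fpeval p x.
Proof.
rewrite /fpeval big_map scaler_sumr; apply: eq_bigr => wa _.
by rewrite tensmxZr.
Qed.

(** The norm of a block-diagonal matrix is the larger of the norms of its blocks. One direction
    makes [G_delta] closed under direct sums, the other lets a direct sum leave every set that a
    summand leaves. *)
Lemma Gset_dsum r s (delta : fpoly R d r s) n m (x : 'I_d -> 'M[C]_n.+1)
    (y : 'I_d -> 'M[C]_m.+1) :
  Gset delta (mkpt (dsum x y)) <-> Gset delta (mkpt x) /\ Gset delta (mkpt y).
Proof.
rewrite /Gset /= fpeval_dsum opnorm_castmx; split=> [lt1|[ltx lty]].
  by split; apply: le_lt_trans lt1; [exact: opnorm_block_gel|exact: opnorm_block_ger].
apply: (@le_lt_trans _ _ (Num.max (opnorm (fpeval delta x)) (opnorm (fpeval delta y)))).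
  by apply: opnorm_block_le; rewrite le_max lexx ?orbT.
by rewrite gt_max ltx lty.
Qed.

Lemma Kset_dsum r s (delta : fpoly R d r s) n m (x : 'I_d -> 'M[C]_n.+1)
    (y : 'I_d -> 'M[C]_m.+1) :
  Kset delta (mkpt x) -> Kset delta (mkpt y) -> Kset delta (mkpt (dsum x y)).
Proof. by rewrite /Kset /= fpeval_dsum opnorm_castmx; exact: opnorm_block_le. Qed.

(** Each [K_delta] is closed under direct sums, hence so is any intersection of such sets. *)
Lemma poly_hull_dsum (E : set (pt R d)) n m (x : 'I_d -> 'M[C]_n.+1)
    (y : 'I_d -> 'M[C]_m.+1) :
  poly_hull E (mkpt x) -> poly_hull E (mkpt y) -> poly_hull E (mkpt (dsum x y)).
Proof. by move=> hx hy r s delta EK; apply: Kset_dsum; [exact: hx|exact: hy]. Qed.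

(** * Scalar polynomials, pointwise interpolation and finite subcovers *)

(** Kept apart from [fpeval] with 1 by 1 coefficients, whose values have size [n * 1], so that the
    values act directly on vectors of length [n]. *)
Definition scalar_ev (g : seq (word d * C)) n (x : 'I_d -> 'M[C]_n) : 'M[C]_n :=
  \sum_(wa <- g) wa.2 *: word_ev wa.1 x.

Lemma scalar_ev_dsum g n m (x : 'I_d -> 'M[C]_n.+1) (y : 'I_d -> 'M[C]_m.+1) :
  scalar_ev g (dsum x y) = block_mx (scalar_ev g x) 0 0 (scalar_ev g y)
    :> 'M[C]_(n.+1 + m.+1).
Proof.
rewrite /scalar_ev; elim: g => [|[w c] g IH]; first by rewrite !big_nil block_mx0.
rewrite !big_cons IH word_ev_dsum /=.
set S := block_mx (\sum_(wa <- g) _) _ _ _.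
rewrite -[LHS]/(c *: block_mx (word_ev w x) 0 0 (word_ev w y) + S).
rewrite scale_block_mx add_block_mx.
by rewrite !scaler0 !addr0.
Qed.

Lemma tens_scalar_ev g k h (M : 'M[C]_(k, h)) n (x : 'I_d -> 'M[C]_n) :
  tensmx (scalar_ev g x) M = fpeval [seq (wa.1, wa.2 *: M) | wa <- g] x.
Proof.
rewrite /scalar_ev /fpeval big_map; elim: g => [|wa g IH].
  by rewrite !big_nil tens0mx.
by rewrite !big_cons tensmxDl IH tensmxZl.
Qed.

Lemma entries_fpeval k h n (x : 'I_d -> 'M[C]_n) (F : 'M[C]_(n * k, n * h)) :
  (forall a b, exists g, entry a b F = scalar_ev g x) ->
  exists p : fpoly R d k h, fpeval p x = F.
Proof.
move=> hF; rewrite (entry_sum F).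
have pol0 : exists p : fpoly R d k h, fpeval p x = 0.
  by exists [::]; rewrite /fpeval big_nil.
have polD A B : (exists p : fpoly R d k h, fpeval p x = A) ->
    (exists p : fpoly R d k h, fpeval p x = B) ->
    exists p : fpoly R d k h, fpeval p x = A + B.
  by move=> [p <-] [q <-]; exists (p ++ q); rewrite fpeval_cat.
apply: (big_ind (fun A => exists p : fpoly R d k h, fpeval p x = A)) => // a _.
apply: (big_ind (fun A => exists p : fpoly R d k h, fpeval p x = A)) => // b _.
by have [g ->] := hF a b; eexists; rewrite tens_scalar_ev.
Qed.

(* The vectors [g(z) v] form a [z]-invariant subspace; with [P] its orthogonal
   projection, conjugating [z] by [1 + (t-1)P] does not increase [|delta|], whereas it
   multiplies the corner [(1-P) f(z) P] by [t]. Boundedness of [f] kills the corner. *)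
Lemma nc_bounded_invariant k h r s (delta : fpoly R d r s) (f : gfun R d k h)
    n (z : 'I_d -> 'M[C]_n.+1) (v : 'cV[C]_n.+1) a b :
  bounded_on (Gset delta) f -> nc_on (Gset delta) f -> Gset delta (mkpt z) ->
  exists g, entry a b (f n z) *m v = scalar_ev g z *m v.
Proof.
move=> [B fB] [_ fsim] Gz.
pose V (u : 'cV[C]_n.+1) := exists g, u = scalar_ev g z *m v.
have V0 : V 0 by exists [::]; rewrite /scalar_ev big_nil mul0mx.
have VD u1 u2 : V u1 -> V u2 -> V (u1 + u2).
  by move=> [g1 ->] [g2 ->]; exists (g1 ++ g2); rewrite /scalar_ev big_cat mulmxDl.
have VZ c u : V u -> V (c *: u).
  move=> [g ->]; exists [seq (wa.1, c * wa.2) | wa <- g].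
  rewrite scalemxAl /scalar_ev big_map scaler_sumr; congr (_ *m _).
  by apply: eq_bigr => wa _; rewrite scalerA.
have Vz i u : V u -> V (z i *m u).
  move=> [g ->]; exists [seq (i :: wa.1, wa.2) | wa <- g].
  rewrite mulmxA /scalar_ev big_map mulmx_sumr; congr (_ *m _).
  by apply: eq_bigr => wa _; rewrite scalemxAr.
have Vw w u : V u -> V (word_ev w z *m u).
  move=> Vu; elim: w => [|i w IH] /=; first by rewrite mul1mx.
  by rewrite -mulmxA; apply: Vz.
have Vv : V v.
  by exists [:: ([::], 1)]; rewrite /scalar_ev big_seq1 scale1r mul1mx.
have [P [hP VP PV]] := orthoproj_exists V0 VD VZ.
(* The range of [P] is [V], which every word in [z] maps into itself. *)
have inv w : P *m word_ev w z *m P = word_ev w z *m P.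
  by apply: mulmx_ext => u; rewrite -!mulmxA PV //; apply/Vw/VP.
have dil t : 1 <= t ->
    Gset delta (mkpt (simil (1%:M + (t - 1)%:C *: P) z)) /\
    f n (simil (1%:M + (t - 1)%:C *: P) z) =
    (1%:M + (t^-1 - 1)%:C *: tensmx P 1%:M) *m f n z
      *m (1%:M + (t - 1)%:C *: tensmx P 1%:M).
  move=> t1; set s1 := 1%:M + _.
  have t0 : t != 0 by rewrite gt_eqF // (lt_le_trans ltr01).
  have ss : s1 *m (1%:M + (t^-1 - 1)%:C *: P) = 1%:M.
    rewrite /s1 mulmxDl mul1mx -scalemxAl mulmxDr mulmx1 -scalemxAr (proj1 hP).
    rewrite scalerDr scalerA -[LHS]addrA -!scalerDl -[RHS]addr0; congr (_ + _).
    suff -> : (t^-1 - 1)%:C + ((t - 1)%:C + (t - 1)%:C * (t^-1 - 1)%:C) = 0 :> C.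
      by rewrite scale0r.
    rewrite -rmorphM -!rmorphD -[RHS](rmorph0 (real_complex R)); congr (_%:C).
    by field.
  have [us1 _] := mulmx1_unit ss.
  have inv1 : invmx s1 = 1%:M + (t^-1 - 1)%:C *: P.
    by rewrite -[RHS](mulKmx us1) ss mulmx1.
  have Gs : Gset delta (mkpt (simil s1 z)).
    rewrite /Gset /= fpeval_simil // inv1 !tensmx1DZ.
    apply: le_lt_trans Gz; apply: opnorm_dilation => //; try exact: orthoproj_tens1.
    rewrite /fpeval mulmx_sumr !mulmx_suml; apply: eq_bigr => wa _.
    by rewrite !tensmx_mul inv mul1mx mulmx1.
  by split=> //; rewrite fsim // inv1 !tensmx1DZ.
(* All dilated points stay in [G_delta], so the one bound [B] serves for every [t]. *)
have fP : tensmx P 1%:M *m f n z *m tensmx P 1%:M = f n z *m tensmx P 1%:M.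
  apply: (@orthoproj_dilation_bounded _ _ _ _ _ _ B); try exact: orthoproj_tens1.
  by move=> t t1; have [Gt <-] := dil t t1; exact: (fB _ Gt).
(* Slicing [fP] shows that the slice of [f z] maps the range of [P] into itself, and [v = P v] lies
   in that range. *)
have : V (entry a b (f n z) *m v); last by [].
have eP : P *m entry a b (f n z) *m P = entry a b (f n z) *m P.
  rewrite -entry_tensmul fP -[entry a b (f n z)]mul1mx -entry_tensmul.
  by rewrite tensmx11 mul1mx.
by rewrite -(PV v Vv) mulmxA -eP -mulmxA -mulmxA; exact: VP.
Qed.

(** Here [z] is the direct sum of [m + 1] copies of [y], and [L] stacks the columns of a matrix into
    one vector. A statement about a single vector at [z] thus becomes one about a whole matrix at
    [y]. *)
Lemma nc_copies k h (D : set (pt R d)) (f : gfun R d k h) n (y : 'I_d -> 'M[C]_n.+1) m :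
  (forall n m (x : 'I_d -> 'M[C]_n.+1) (y : 'I_d -> 'M[C]_m.+1),
     D (mkpt x) -> D (mkpt y) -> D (mkpt (dsum x y))) ->
  nc_on D f -> D (mkpt y) ->
  exists N (z : 'I_d -> 'M[C]_N.+1) (L : 'M[C]_(n.+1, m.+1) -> 'cV[C]_N.+1),
    [/\ D (mkpt z), injective L,
        forall g X, scalar_ev g z *m L X = L (scalar_ev g y *m X)
      & forall a b X, entry a b (f N z) *m L X = L (entry a b (f n y) *m X)].
Proof.
move=> DD [fdsum _] Dy; elim: m => [|m [N [z [L [Dz Linj Lg Lf]]]]].
  by exists n, y, id; split.
(* One column is split off for the new copy of [y]; the others are stacked by [L]. *)
pose L' (X : 'M[C]_(n.+1, 1 + m.+1)) : 'cV[C]_(n.+1 + N.+1) :=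
  col_mx (lsubmx X) (L (rsubmx X)).
have L'mul (A : 'M[C]_n.+1) (B : 'M[C]_N.+1) X :
    (forall Y, B *m L Y = L (A *m Y)) -> block_mx A 0 0 B *m L' X = L' (A *m X).
  move=> AB; rewrite /L' mul_block_diag_col AB.
  by rewrite -{3 4}[X]hsubmxK mul_mx_row row_mxKl row_mxKr.
have L'inj : injective L'.
  move=> X Y; rewrite /L' => /eq_col_mx[eql /Linj eqr].
  by rewrite -[X]hsubmxK -[Y]hsubmxK eql eqr.
exists (n + N.+1)%N, (dsum y z), L'; split.
- exact: DD.
- exact: L'inj.
- by move=> g X; rewrite scalar_ev_dsum; exact: L'mul.
- by move=> a b X; rewrite fdsum // (entry_block_diag a b (f n y)); exact: L'mul.
Qed.

(** [nc_bounded_invariant] alone gives a polynomial depending on the vector. Applied to the stacked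
    columns of the identity matrix, it gives one [g] valid for all vectors, since [L] is
    injective. *)
Lemma nc_bounded_polynomial k h r s (delta : fpoly R d r s) (f : gfun R d k h)
    n (y : 'I_d -> 'M[C]_n.+1) :
  bounded_on (Gset delta) f -> nc_on (Gset delta) f -> Gset delta (mkpt y) ->
  exists p : fpoly R d k h, fpeval p y = f n y.
Proof.
move=> fb fnc Gy; apply: entries_fpeval => a b.
have [|N [z [L [Gz Linj Lg Lf]]]] := @nc_copies k h _ f n y n _ fnc Gy.
  by move=> n1 n2 x1 x2 G1 G2; apply/Gset_dsum.
have [g] := nc_bounded_invariant (L 1%:M) a b fb fnc Gz.
by rewrite Lf Lg !mulmx1 => /Linj eg; exists g.
Qed.

(* As [E] is closed under direct sums, a finite subcover by sets [G_delta] already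
   contains a single [G_delta] covering [E]. *)
Lemma free_compact_single_cover (E : set (pt R d))
    (good : forall r s, fpoly R d r s -> Prop) :
  free_compact E -> E !=set0 ->
  (forall n m (x : 'I_d -> 'M[C]_n.+1) (y : 'I_d -> 'M[C]_m.+1),
     E (mkpt x) -> E (mkpt y) -> E (mkpt (dsum x y))) ->
  (forall q, E q -> exists r s (delta : fpoly R d r s), good r s delta /\ Gset delta q) ->
  exists r s (delta : fpoly R d r s), good r s delta /\ E `<=` Gset delta.
Proof.
move=> Ec [q0 Eq0] EE cov.
pose I := {r & {s & {delta : fpoly R d r s | good r s delta}}}.
pose V (i : I) : set (pt R d) := Gset (sval (projT2 (projT2 i))).
have [i p Vp||l El] := Ec I V.
- exists (projT1 i), (projT1 (projT2 i)), (sval (projT2 (projT2 i))); split=> //.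
- move=> q /cov[r [s [delta [gd Gq]]]].
  by exists (existT _ r (existT _ s (exist _ delta gd))).
apply: contrapT => none.
have notV (i : I) : exists2 q, E q & ~ V i q.
  apply: contrapT => h; apply: none.
  case: i h => r [s [delta gd]] h; exists r, s, delta; split=> // q Eq.
  by apply: contrapT => nG; apply: h; exists q.
(* The direct sum of points missed by the individual members is missed by all of them; [q0] starts
   the sum, as there is no empty direct sum. *)
have [q Eq nV] : exists2 q, E q & forall i, List.In i l -> ~ V i q.
  elim: l {El} => [|i l [[n x] Ex nV]]; first by exists q0.
  have [[m y] Ey nVy] := notV i.
  exists (mkpt (dsum x y)) => [|j]; first exact: EE.
  move=> /= [<-|jl] /Gset_dsum[]; last by move=> /(nV _ jl).
  by move=> _ /nVy.
by have [i /= /nV nVq Vq] := El q Eq.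
Qed.

End FreePolynomials.

Theorem theorem9p7 (R : realType) (d k h : nat) (E U : set (pt R d))
  (phi : gfun R d k h) :
  free_compact E -> poly_convex E ->
  free_open U -> E `<=` U -> free_holomorphic U phi ->
  forall eps : R, 0 < eps ->
  exists p : fpoly R d k h,
    exists2 delta : R, delta < eps &
      forall q, E q -> opnorm (phi (projT1 q) (projT2 q) - fpeval p (projT2 q)) <= delta.
Proof.
move=> Ec [_ hullE] _ EU holo eps eps0.
have EE n m (x : 'I_d -> 'M[R[i]]_n.+1) (y : 'I_d -> 'M[R[i]]_m.+1) :
    E (mkpt x) -> E (mkpt y) -> E (mkpt (dsum x y)).
  by rewrite -hullE; exact: poly_hull_dsum.
have [E0|/set0P E0] := eqVneq E set0.
  by exists [::], 0 => // q; rewrite E0.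
(* The test polynomials have the coefficients of [phi], so that the difference of two interpolants
   is among them. *)
pose generic (q : pt R d) := forall g : fpoly R d k h,
  fpeval g (projT2 q) = 0 -> forall x, E x -> fpeval g (projT2 x) = 0.
(* Near a non-generic point, a large multiple of a polynomial vanishing there but not
   on [E] gives a neighbourhood that does not contain [E]. *)
pose good r s (delta : fpoly R d r s) := ~ (E `<=` Gset delta) \/
  exists q, [/\ E q, generic q, bounded_on (Gset delta) phi & nc_on (Gset delta) phi].
have cov q : E q -> exists r s (delta : fpoly R d r s), good r s delta /\ Gset delta q.
  move=> Eq; have [gq|] := pselect (generic q).
    have [r [s [delta [Gq _ bd nc]]]] := holo q (EU _ Eq).
    by exists r, s, delta; split=> //; right; exists q.
  move=> /existsNP[g /not_implyP[gq0 /existsNP[x /not_implyP[Ex gx]]]].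
  have [c c1] := opnorm_scale_ge1 gx.
  exists k, h, (fpscale c g); split.
    by left=> /(_ x Ex); rewrite /Gset /= fpeval_scale ltNge c1.
  by rewrite /Gset /= fpeval_scale gq0 scaler0 opnorm0.
(* A single [G_delta] contains [E], which rules out the first alternative of [good] and leaves a
   generic point [y]. *)
have [r [s [delta [[//|[[n y] [Ey gen bd nc]]] EG]]]] :=
  free_compact_single_cover Ec E0 EE cov.
have [p py] := nc_bounded_polynomial bd nc (EG _ Ey).
(* The error is zero: the interpolant at [y] will equal [phi] on all of [E]. *)
exists p, 0 => // -[m x] Ex /=.
(* Interpolating at [y (+) x] and comparing diagonal blocks gives one [q] with the values of [phi]
   at both [y] and [x]. *)
have [q qyx] := nc_bounded_polynomial bd nc (EG _ (EE _ _ _ _ Ey Ex)).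
move: qyx; rewrite fpeval_dsum (proj1 nc) //; try exact: EG.
move=> /castmx_injective /eq_block_mx[qy _ _ qx].
(* The difference [q - p] vanishes at [y], hence at [x], where [q] equals [phi]. *)
have := gen (q ++ fpscale (-1) p); rewrite /= !fpeval_cat !fpeval_scale qy py.
rewrite scaleN1r subrr => /(_ erefl _ Ex) /=.
by rewrite fpeval_cat fpeval_scale scaleN1r qx => ->; rewrite opnorm0.
Qed.
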